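(* Let $V$ be a finite-dimensional vector space over a field $\mathbf{k}$ of characteristic zero and let $w\in\Lambda^2(V)$. The quantum exterior product $\wedge_h$ on $\Lambda_h(V^* )=\Lambda(V^* )[h]$ defined by $w$ satisfies: (i) (supercommutativity) $\alpha\wedge_h\beta=(-1)^{|\alpha||\beta|}\beta\wedge_h\alpha$ for all homogeneous $\alpha,\beta\in\Lambda_h(V^* )$; (ii) (associativity) $(\alpha\wedge_h\beta)\wedge_h\gamma=\alpha\wedge_h(\beta\wedge_h\gamma)$ for all $\alpha,\beta,\gamma\in\Lambda_h(V^* )$. Therefore $(\Lambda_h(V^* ),\wedge_h)$ is a deformation quantization of the exterior algebra $(\Lambda(V^* ),\wedge)$.
   Context: Let $\{e_i\}$ be a basis of $V$ with dual basis $\{e^i\}$; write $w$ as the antisymmetric tensor with components $w^{ij}=w(e^i,e^j)=-w^{ji}$ (repeated indices are summed). For $v\in V$ and $\alpha\in\Lambda^k(V^* )$, $v\vdash\alpha$ is contraction in the first slot, $(v\vdash\alpha)(v_1,\dots,v_{k-1})=\alpha(v,v_1,\dots,v_{k-1})$, and $\alpha\dashv v$ is contraction in the last slot, $(\alpha\dashv v)(v_1,\dots,v_{k-1})=\alpha(v_1,\dots,v_{k-1},v)$. For $\alpha,\beta\in\Lambda(V^* )$, $$\alpha\wedge_h\beta=\sum_{n\ge0}\frac{h^n}{n!}w^{i_1j_1}\cdots w^{i_nj_n}(\alpha\dashv e_{i_1}\dashv\cdots\dashv e_{i_n})\wedge(e_{j_n}\vdash\cdots\vdash e_{j_1}\vdash\beta)\in\Lambda(V^*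 )[h],$$ where the contractions on $\alpha$ are by $e_{i_1}$ first, then $e_{i_2}$, etc., and those on $\beta$ by $e_{j_1}$ first, then $e_{j_2}$, etc. This is independent of the basis and is extended $\mathbf{k}[h]$-bilinearly to $\Lambda_h(V^* )$. Grading: elements of $\Lambda^p(V^* )$ have degree $p$ and $h$ has degree $2$; $|\alpha|$ denotes the degree. A deformation quantization of a unital $\mathbf{k}$-algebra $A$ is an algebra $A_h$ over $\mathbf{k}[h]$ isomorphic to $A\otimes_{\mathbf{k}}\mathbf{k}[h]$ as a $\mathbf{k}[h]$-module and such that $A_h/hA_h\cong A$ as algebras. *)

(* Defs.v *)
From HB Require Import structures.
From mathcomp Require Import all_boot all_order all_algebra.
From mathcomp Require Import boolp functions.

Set Implicit Arguments.
Unset Strict Implicit.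
Unset Printing Implicit Defensive.

Import GRing.Theory.
Local Open Scope ring_scope.

(* [inversions m] is the number of pairs i < j with m_i = false and m_j = true:
   the length of the shuffle that moves the entries selected by m to the
   front. *)
Fixpoint inversions (m : bitseq) : nat :=
  if m is b :: m' then ((if b then 0 else count id m') + inversions m')%N
  else 0%N.

Section ExteriorAlgebra.
Variables (k : fieldType) (V : vectType k).
Implicit Types (f g : seq V -> k^o) (s t : seq V) (u v : V).

(* A function on finite sequences of vectors is read as the family of its
   restrictions to V^p, p >= 0.  An element of Lambda(V^* ) is such a family in
   which each component is an alternating p-linear form.  Components of degree
   p > dim V then vanish (extalg_gt_dim below), so that these families form the
   direct sum of the Lambda^p(V^* ). *)
Definition multilinear f := forall s t (a : k) u v,
  f (s ++ (a *: u + v) :: t) = a * f (s ++ u :: t) + f (s ++ v :: t).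

Definition alternating f := forall s, ~~ uniq s -> f s = 0.

Definition altform : {pred (seq V -> k^o)} :=
  fun f => `[< multilinear f /\ alternating f >].

Lemma altformP f : reflect (multilinear f /\ alternating f) (f \in altform).
Proof. exact: asboolP. Qed.

Lemma altform_submod_closed : submod_closed altform.
Proof.
split=> [|a f g /altformP[mf af] /altformP[mg ag]]; apply/altformP; split.
- by move=> s t a u v; rewrite /= mulr0 addr0.
- by [].
- move=> s t b u v.
  have E r : (a *: f + g) r = a * f r + g r by [].
  by rewrite !E mf mg !mulrDr !mulrA [b * a]mulrC addrACA.
- move=> s us; have E r : (a *: f + g) r = a * f r + g r by [].
  by rewrite E af // ag // mulr0 addr0.
Qed.

HB.instance Definition _ :=
  GRing.isSubmodClosed.Build k (seq V -> k^o) altform altform_submod_closed.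

Record extalg := ExtAlg { extfun :> seq V -> k^o; _ : extfun \in altform }.

HB.instance Definition _ := [isSub for extfun].
HB.instance Definition _ := [Choice of extalg by <:].
HB.instance Definition _ := [SubChoice_isSubLmodule of extalg by <:].

Implicit Types (x y z : extalg).

Lemma extP x y : (forall s, x s = y s) -> x = y.
Proof. by move=> xy; apply/val_inj/funext. Qed.

Lemma ext_lin x s t (a : k) u v :
  x (s ++ (a *: u + v) :: t) = a * x (s ++ u :: t) + x (s ++ v :: t).
Proof. by case/altformP: (valP x) => + _; apply. Qed.

Lemma ext_alt x s : ~~ uniq s -> x s = 0.
Proof. by case/altformP: (valP x) => _; apply. Qed.

Lemma extDE x y s : (x + y) s = x s + y s. Proof. by []. Qed.
Lemma extZE (a : k) x s : (a *: x) s = a * x s. Proof. by []. Qed.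

Lemma extalg_gt_dim x s : (\dim {: V} < size s)%N -> x s = 0.
Proof.
move=> ds.
have : ~~ free (in_tuple s).
  apply: contraL ds => /eqP fs; rewrite -leqNgt -[size s]fs.
  exact/dimvS/subvf.
rewrite freeNE => /existsP[i] /=.
have si : s = take i s ++ s`_i :: drop i.+1 s.
  by rewrite -drop_nth // cat_take_drop.
move: (s`_i) (take i s) (drop i.+1 s) si => v s1 s2 -> {ds i s}.
rewrite -[s2 in <<s2>>%VS](in_tupleE s2) => /coord_span ->.
have x0 : x (s1 ++ 0 :: s2) = 0.
  have := ext_lin x s1 s2 (-1) 0 0; rewrite scaler0 addr0 => ->.
  by rewrite mulN1r addNr.
elim/big_ind: _ => // [u u1 xu xv|j _].
  by rewrite -[u]scale1r ext_lin xu xv mulr0 addr0.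
rewrite -[_ *: _]addr0 ext_lin x0 addr0 ext_alt ?mulr0 //.
rewrite cat_uniq negb_and; apply/orP; right; rewrite negb_and; apply/orP.
by right; rewrite /= mem_nth.
Qed.

(* v |- x and x -| v *)
Definition lcontr_fun v f : seq V -> k^o := fun s => f (v :: s).
Definition rcontr_fun f v : seq V -> k^o := fun s => f (rcons s v).

Lemma lcontr_subproof v x : lcontr_fun v x \in altform.
Proof.
apply/altformP; split=> [s t a u u'|s us]; first exact: (ext_lin x (v :: s)).
by apply: ext_alt; rewrite /= negb_and us orbT.
Qed.

Lemma rcontr_subproof x v : rcontr_fun x v \in altform.
Proof.
apply/altformP; split=> [s t a u u'|s us].
  by rewrite /rcontr_fun !rcons_cat /= ext_lin.
by apply: ext_alt; rewrite rcons_uniq negb_and us orbT.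
Qed.

Definition lcontr v x : extalg := ExtAlg (lcontr_subproof v x).
Definition rcontr x v : extalg := ExtAlg (rcontr_subproof x v).

(* (f /\ g)(v_1, .., v_r) is the sum, over the ways to distribute the v_i (in
   order) between f and g, of the signed products of values; on Lambda^p and
   Lambda^q this is the wedge product
   1/(p! q!) \sum_(sigma in S_(p+q)) sgn(sigma) f(v_sigma(1), ..) g(.., v_sigma(p+q)). *)
Definition wedge_fun f g : seq V -> k^o := fun s =>
  \sum_(m : (size s).-tuple bool)
    (-1) ^+ inversions m * (f (mask m s) * g (mask (map negb m) s)).

Let sg f : seq V -> k^o := fun s => (-1) ^+ size s * f s.

Lemma wedge_fun_nil f g : wedge_fun f g [::] = f [::] * g [::].
Proof.
rewrite /wedge_fun (bigD1 [tuple]) //= big1 ?addr0 ?mul1r //.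
by move=> m; rewrite (tuple0 m).
Qed.

Lemma wedge_fun_cons f g v s : wedge_fun f g (v :: s) =
  wedge_fun (lcontr_fun v f) g s + wedge_fun (sg f) (lcontr_fun v g) s.
Proof.
rewrite /wedge_fun /=.
pose F (p : bool * (size s).-tuple bool) : (size s).+1.-tuple bool :=
  [tuple of p.1 :: p.2].
rewrite (reindex F); last first.
  exists (fun q => (thead q, [tuple of behead q])) => [[b m] _|q _] /=.
    by congr (_, _); apply: val_inj.
  by rewrite /F /= -tuple_eta.
rewrite -(pair_big xpredT xpredT (fun b m => (-1) ^+ inversions (F (b, m)) *
   (f (mask (F (b, m)) (v :: s)) * g (mask (map negb (F (b, m))) (v :: s))))).
rewrite big_bool /=; congr (_ + _); apply: eq_bigr => m _ //.
rewrite /sg /lcontr_fun size_mask ?size_tuple // exprD.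
by rewrite [_ * (-1) ^+ inversions _]mulrC !mulrA.
Qed.

Lemma wedge_fun_linl (a : k) f f' g s :
  wedge_fun (fun r => a * f r + f' r) g s
  = a * wedge_fun f g s + wedge_fun f' g s.
Proof.
rewrite /wedge_fun mulr_sumr -big_split; apply: eq_bigr => m _ /=.
by rewrite mulrDl mulrDr -[a * _ * _]mulrA [_ * (a * _)]mulrCA.
Qed.

Lemma wedge_fun_linr (a : k) f g g' s :
  wedge_fun f (fun r => a * g r + g' r) s
  = a * wedge_fun f g s + wedge_fun f g' s.
Proof.
rewrite /wedge_fun mulr_sumr -big_split; apply: eq_bigr => m _ /=.
by rewrite !mulrDr [f _ * (a * _)]mulrCA [_ * (a * _)]mulrCA.
Qed.

Lemma wedge_fun0l f g s : f =1 (fun=> 0) -> wedge_fun f g s = 0.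
Proof. by move=> f0; apply: big1 => m _; rewrite f0 mul0r mulr0. Qed.

Lemma wedge_fun0r f g s : g =1 (fun=> 0) -> wedge_fun f g s = 0.
Proof. by move=> g0; apply: big1 => m _; rewrite g0 !mulr0. Qed.

Lemma eq_wedge_fun f f' g g' : f =1 f' -> g =1 g' ->
  wedge_fun f g =1 wedge_fun f' g'.
Proof. by move=> /funext-> /funext->. Qed.

Lemma wedge_funNl f g s : wedge_fun (fun r => - f r) g s = - wedge_fun f g s.
Proof.
rewrite (@eq_wedge_fun _ (fun r => -1 * f r + 0) _ g) //.
  by rewrite wedge_fun_linl mulN1r [X in _ + X]wedge_fun0l // addr0.
by move=> r; rewrite mulN1r addr0.
Qed.

Lemma wedge_funNr f g s : wedge_fun f (fun r => - g r) s = - wedge_fun f g s.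
Proof.
rewrite (@eq_wedge_fun _ f _ (fun r => -1 * g r + 0)) //.
  by rewrite wedge_fun_linr mulN1r [X in _ + X]wedge_fun0r // addr0.
by move=> r; rewrite mulN1r addr0.
Qed.

Lemma wedge_funDl f f' g s :
  wedge_fun (fun r => f r + f' r) g s = wedge_fun f g s + wedge_fun f' g s.
Proof.
rewrite -[wedge_fun f g s]mul1r -wedge_fun_linl; apply: eq_wedge_fun => // r.
by rewrite mul1r.
Qed.

Lemma wedge_funDr f g g' s :
  wedge_fun f (fun r => g r + g' r) s = wedge_fun f g s + wedge_fun f g' s.
Proof.
rewrite -[wedge_fun f g s]mul1r -wedge_fun_linr; apply: eq_wedge_fun => // r.
by rewrite mul1r.
Qed.

Lemma lcontr_sg v f : lcontr_fun v (sg f) =1 (fun r => - sg (lcontr_fun v f) r).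
Proof. by move=> r; rewrite /lcontr_fun /sg /= exprS mulN1r mulNr. Qed.

Lemma sgK f : sg (sg f) =1 f.
Proof. by move=> r; rewrite /sg mulrA -expr2 sqrr_sign mul1r. Qed.

Lemma sg_wedge f g : sg (wedge_fun f g) =1 wedge_fun (sg f) (sg g).
Proof.
move=> s; elim: s f g => [|v s IHs] f g.
  by rewrite /sg /= !wedge_fun_nil /= !mul1r.
rewrite wedge_fun_cons (eq_wedge_fun (lcontr_sg v f) (frefl _)).
rewrite (eq_wedge_fun (frefl (sg (sg f))) (lcontr_sg v g)).
rewrite wedge_funNl wedge_funNr -!IHs {1}/sg wedge_fun_cons /=.
by rewrite exprS mulN1r mulNr mulrDr opprD.
Qed.

Lemma wedge_funA f g h s :
  wedge_fun f (wedge_fun g h) s = wedge_fun (wedge_fun f g) h s.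
Proof.
elim: s f g h => [|v s IHs] f g h; first by rewrite !wedge_fun_nil mulrA.
rewrite !wedge_fun_cons.
rewrite (eq_wedge_fun (frefl (sg f)) (fun r => wedge_fun_cons g h v r)).
rewrite (eq_wedge_fun (fun r => wedge_fun_cons f g v r) (frefl h)).
rewrite (eq_wedge_fun (sg_wedge f g) (frefl (lcontr_fun v h))).
by rewrite wedge_funDl wedge_funDr !IHs addrA.
Qed.

Lemma multilinear_lcontr v f : multilinear f -> multilinear (lcontr_fun v f).
Proof. by move=> mf s; apply: (mf (v :: s)). Qed.

Lemma multilinear_sg f : multilinear f -> multilinear (sg f).
Proof.
move=> mf s t a u v; rewrite /sg mf !size_cat /= mulrDr.
by rewrite [_ * (a * _)]mulrCA.
Qed.

Lemma multilinear_wedge f g : multilinear f -> multilinear g ->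
  multilinear (wedge_fun f g).
Proof.
move=> + + s; elim: s f g => [|x s IHs] f g mf mg t a u v /=; rewrite !wedge_fun_cons.
  rewrite (@eq_wedge_fun (lcontr_fun (a *: u + v) f)
     (fun r => a * lcontr_fun u f r + lcontr_fun v f r) g g) //; last first.
    by move=> r; apply: (mf [::]).
  rewrite (@eq_wedge_fun (sg f) (sg f) (lcontr_fun (a *: u + v) g)
     (fun r => a * lcontr_fun u g r + lcontr_fun v g r)) //; last first.
    by move=> r; apply: (mg [::]).
  by rewrite wedge_fun_linl wedge_fun_linr mulrDr addrACA.
rewrite !IHs; try by [apply: multilinear_lcontr | apply: multilinear_sg |].
by rewrite mulrDr addrACA.
Qed.

(* For multilinear f it suffices to test two equal adjacent arguments. *)
Lemma alternating_adjacent f : multilinear f ->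
  (forall s v t, f (s ++ v :: v :: t) = 0) -> alternating f.
Proof.
move=> mf f0.
have fD s u v t : f (s ++ (u + v) :: t) = f (s ++ u :: t) + f (s ++ v :: t).
  by rewrite -[u in LHS]scale1r mf mul1r.
have swap s u v t : f (s ++ u :: v :: t) = - f (s ++ v :: u :: t).
  apply/eqP; rewrite -addr_eq0; apply/eqP; rewrite -[RHS](f0 s (u + v) t).
  rewrite fD -!(cat_rcons _ s) !fD !cat_rcons !f0.
  by rewrite add0r addr0.
have far s v t1 t2 : f (s ++ v :: t1 ++ v :: t2) = 0.
  elim: t1 s => [|u t1 IH] s; first exact: f0.
  by rewrite /= swap -cat_rcons IH oppr0.
move=> s us; suff H r : forall q, ~~ uniq r -> f (q ++ r) = 0 by apply: (H s [::]).
elim: r => // y r IHr q; rewrite /= negb_and negbK => /orP[yr|ur].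
  by case/splitPr: yr => t1 t2; apply: far.
by rewrite -cat_rcons IHr.
Qed.

Lemma alternating_wedge f g : multilinear f -> alternating f ->
  multilinear g -> alternating g -> alternating (wedge_fun f g).
Proof.
move=> mf af mg ag; apply: alternating_adjacent.
  exact: multilinear_wedge.
move=> s v t.
have {}af r q : f (r ++ v :: v :: q) = 0.
  by apply: af; rewrite cat_uniq /= inE eqxx /= !andbF.
have {}ag r q : g (r ++ v :: v :: q) = 0.
  by apply: ag; rewrite cat_uniq /= inE eqxx /= !andbF.
move: af ag {mf mg}; elim: s f g => [|u s IHs] f g af ag /=.
  rewrite !wedge_fun_cons.
  rewrite wedge_fun0l; last by move=> r; apply: (af [::]).
  rewrite [X in _ + (_ + X)]wedge_fun0r; last by move=> r; apply: (ag [::]).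
  rewrite (eq_wedge_fun (lcontr_sg v f) (frefl _)) wedge_funNl.
  by rewrite add0r addr0 addrN.
rewrite wedge_fun_cons !IHs ?addr0 // => r q.
- by rewrite /sg af mulr0.
- exact: (ag (u :: r)).
- exact: (af (u :: r)).
Qed.

Lemma wedge_subproof x y : wedge_fun x y \in altform.
Proof.
case/altformP: (valP x) => mx ax; case/altformP: (valP y) => my ay.
by apply/altformP; split; [apply: multilinear_wedge | apply: alternating_wedge].
Qed.

Definition wedge x y : extalg := ExtAlg (wedge_subproof x y).

Definition ext_one_fun : seq V -> k^o := fun s => (nilp s)%:R.

Lemma ext_one_subproof : ext_one_fun \in altform.
Proof.
apply/altformP; split=> [[|? ?] t a u v|[|? ?]] //.
all: by rewrite /ext_one_fun /= mulr0 addr0.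
Qed.

Definition ext_one : extalg := ExtAlg ext_one_subproof.

Lemma wedgeA : associative wedge.
Proof. by move=> x y z; apply: extP => s; apply: wedge_funA. Qed.

Lemma wedge1l : left_id ext_one wedge.
Proof.
move=> x; apply: extP => s /=.
elim: s (extfun x) => [|v s IHs] f.
  by rewrite wedge_fun_nil mul1r.
rewrite wedge_fun_cons wedge_fun0l // add0r.
rewrite (@eq_wedge_fun _ ext_one_fun _ (lcontr_fun v f)) ?IHs // => -[|? r].
  exact: mul1r.
exact: mulr0.
Qed.

Lemma wedge1r : right_id ext_one wedge.
Proof.
move=> x; apply: extP => s /=.
elim: s (extfun x) => [|v s IHs] f.
  by rewrite wedge_fun_nil mulr1.
by rewrite wedge_fun_cons IHs wedge_fun0r ?addr0.
Qed.

Lemma wedgeDl : left_distributive wedge +%R.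
Proof. by move=> x y z; apply: extP => s; apply: wedge_funDl. Qed.

Lemma wedgeDr : right_distributive wedge +%R.
Proof. by move=> x y z; apply: extP => s; apply: wedge_funDr. Qed.

Lemma ext_one_neq0 : ext_one != 0.
Proof.
apply/eqP => /(congr1 (fun x : extalg => x [::])) /eqP.
by rewrite /= oner_eq0.
Qed.

HB.instance Definition _ := GRing.Zmodule_isNzRing.Build extalg
  wedgeA wedge1l wedge1r wedgeDl wedgeDr ext_one_neq0.

Lemma wedgeZl (a : k) x y : a *: (x * y) = (a *: x) * y.
Proof.
apply: extP => s; rewrite [RHS](_ : _ = wedge_fun (fun r => a * x r + 0) y s).
  by rewrite wedge_fun_linl [X in _ + X]wedge_fun0l // addr0.
by apply: eq_wedge_fun => // r; rewrite addr0.
Qed.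

HB.instance Definition _ := GRing.Lmodule_isLalgebra.Build k extalg wedgeZl.

Lemma wedgeZr (a : k) x y : a *: (x * y) = x * (a *: y).
Proof.
apply: extP => s; rewrite [RHS](_ : _ = wedge_fun x (fun r => a * y r + 0) s).
  by rewrite wedge_fun_linr [X in _ + X]wedge_fun0r // addr0.
by apply: eq_wedge_fun => // r; rewrite addr0.
Qed.

HB.instance Definition _ := GRing.Lalgebra_isAlgebra.Build k extalg wedgeZr.

Definition of_degree (p : nat) x := forall s, x s != 0 -> size s = p.

End ExteriorAlgebra.

(* A[h] = A (x)_k k[h], as a module over k[h] = {poly k}; the variable h is 'X.
   The alias is needed because {poly A} is already a module over A. *)
Section PolynomialExtension.
Variables (k : fieldType) (A : algType k).

Definition polyh : Type := {poly A}.

HB.instance Definition _ := GRing.Zmodule.on polyh.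

Definition polyh_scale (c : {poly k}) (x : polyh) : polyh :=
  map_poly (in_alg A) c * (x : {poly A}).

Lemma polyh_scaleA a b x :
  polyh_scale a (polyh_scale b x) = polyh_scale (a * b) x.
Proof. by rewrite /polyh_scale rmorphM mulrA. Qed.

Lemma polyh_scale1 : left_id 1 polyh_scale.
Proof. by move=> x; rewrite /polyh_scale rmorph1 mul1r. Qed.

Lemma polyh_scaleDr : right_distributive polyh_scale +%R.
Proof. by move=> c x y; apply: mulrDr. Qed.

Lemma polyh_scaleDl x : {morph polyh_scale^~ x : a b / a + b}.
Proof. by move=> a b; rewrite /polyh_scale rmorphD mulrDl. Qed.

HB.instance Definition _ := GRing.Zmodule_isLmodule.Build {poly k} polyh
  polyh_scaleA polyh_scale1 polyh_scaleDr polyh_scaleDl.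

End PolynomialExtension.

Section DeformationQuantization.
Variable k : fieldType.

Section Algebra.
Variables (M : lmodType {poly k}) (mul : M -> M -> M) (one : M).

Record is_kh_algebra : Prop := IsKhAlgebra {
  kh_mulA : associative mul;
  kh_mul1l : left_id one mul;
  kh_mul1r : right_id one mul;
  kh_mulDl : left_distributive mul +%R;
  kh_mulDr : right_distributive mul +%R;
  kh_scaleAl : forall (c : {poly k}) x y, mul (c *: x) y = c *: mul x y;
  kh_scaleAr : forall (c : {poly k}) x y, mul x (c *: y) = c *: mul x y
}.

End Algebra.

Definition hmultiples (M : lmodType {poly k}) : {pred M} :=
  fun x => `[< exists y : M, x = 'X *: y >].

Lemma hmultiples_zmod_closed (M : lmodType {poly k}) : zmod_closed (@hmultiples M).
Proof.
split=> [|x y /asboolP[u ->] /asboolP[v ->]]; apply/asboolP.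
  by exists 0; rewrite scaler0.
by exists (u - v); rewrite scalerBr.
Qed.

HB.instance Definition _ (M : lmodType {poly k}) :=
  GRing.isZmodClosed.Build M (@hmultiples M) (@hmultiples_zmod_closed M).

(* The operations of the k-algebra M / hM are those induced by M; since every
   class is the class of some x, the conditions on phi below say that it is an
   isomorphism of unital k-algebras from M / hM to A. *)
Definition deformation_quantization (A : algType k) (M : lmodType {poly k})
    (mul : M -> M -> M) (one : M) : Prop :=
  [/\ is_kh_algebra mul one,
      exists psi : {linear M -> polyh A}, bijective psi
    & exists phi : {additive {ideal_quot @hmultiples M} -> A},
      let cl (x : M) := (\pi_({ideal_quot @hmultiples M}) x)%qT in
      [/\ bijective phi,
          phi (cl one) = 1,
          forall x y, phi (cl (mul x y)) = phi (cl x) * phi (cl y)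
        & forall (c : k) x, phi (cl (c%:P *: x)) = c *: phi (cl x)]].

End DeformationQuantization.

Section QuantumExteriorProduct.
Variables (k : fieldType) (V : vectType k).

Definition dualv : vectType k := 'Hom(V, k^o).

Local Notation d := (\dim {: V}).

(* A bivector is an element of degree 2 of extalg dualv, i.e. an alternating
   bilinear form on V^*. *)
Variables (w : extalg dualv) (e : d.-tuple V).

Definition dual_basis (i : 'I_d) : dualv := linfun (coord e i : V -> k^o).

Definition wcoef (i j : 'I_d) : k := w [:: dual_basis i; dual_basis j].

(* In both folds the head of the index tuple is contracted first. *)
Definition qwedge_coef (n : nat) (x y : extalg V) : extalg V :=
  (n`!%:R)^-1 *:
  \sum_(I : n.-tuple 'I_d) \sum_(J : n.-tuple 'I_d)
    (\prod_(m < n) wcoef (tnth I m) (tnth J m)) *: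
    (foldl (fun a i => rcontr a (tnth e i)) x I *
     foldl (fun b j => lcontr (tnth e j) b) y J).

Lemma foldl_rcontr (x : extalg V) (I : seq 'I_d) s :
  foldl (fun a i => rcontr a (tnth e i)) x I s
  = x (s ++ rev (map (tnth e) I)).
Proof.
elim: I x s => [|i I IH] x s /=; first by rewrite cats0.
by rewrite IH /= /rcontr_fun rev_cons rcons_cat.
Qed.

Lemma qwedge_coef_gt_dim n x y : (d < n)%N -> qwedge_coef n x y = 0.
Proof.
move=> dn; rewrite /qwedge_coef big1 ?scaler0 // => I _; apply: big1 => J _.
suff -> : foldl (fun a i => rcontr a (tnth e i)) x I = 0.
  by rewrite mul0r scaler0.
apply: extP => s; rewrite foldl_rcontr extalg_gt_dim //.
by rewrite size_cat size_rev size_map size_tuple ltn_addl.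
Qed.

(* The series stops at n = dim V by qwedge_coef_gt_dim. *)
Definition qwedge_ext (x y : extalg V) : polyh (extalg V) :=
  \poly_(n < d.+1) qwedge_coef n x y.

Definition qwedge (x y : polyh (extalg V)) : polyh (extalg V) :=
  \sum_(a < size (x : {poly extalg V})) \sum_(b < size (y : {poly extalg V}))
    ('X^(a + b) : {poly k}) *:
    qwedge_ext (x : {poly extalg V})`_a (y : {poly extalg V})`_b.

End QuantumExteriorProduct.

(* h has degree 2. *)
Definition homogeneous (k : fieldType) (V : vectType k) (p : nat)
    (x : polyh (extalg V)) :=
  forall (m : nat) (s : seq V),
    (x : {poly extalg V})`_m s != 0 -> (size s + 2 * m)%N = p.

(* Main.v *)
Require Import Defs.
From HB Require Import structures.
From mathcomp Require Import all_boot all_order all_algebra.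
From mathcomp Require Import boolp functions.

(** The product is governed by a differential equation in [h].  Write [c_n x y]
    for the coefficient of [h^n] in the product of two constant forms and [P]
    for the operation
      [P(F)(x, y) = sum_(i,j) w^(ij) F(x contracted on the right by e_i,
                                       y contracted on the left by e_j)].
    Then [c_n = P^n(wedge) / n!], so that [(n+1) c_(n+1) = P(c_n)]: the
    derivative of the product with respect to [h] is its pairing through [w].

    Associativity.  Contraction by a vector is a superderivation of the wedge
    product, and since contractions anticommute it remains one of every [c_n]
    (lemmas [lcontr_qwedge_coef], [rcontr_qwedge_coef]): the two signs that
    arise from moving it past [e_i] and from the grading involution cancel.
    Differentiate a triple product of [x, y, z].  The outer product contributes
    a pairing of an inner product with the third factor, and the derivation
    rule splits it into pairings of single factors.  For both bracketings the
    derivative is thus the same sum over the pairs of factors [(x, y)],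
    [(x, z)], [(y, z)] of the triple product of the contracted factors
    ([left_tripleS], [right_tripleS]).  In characteristic zero a polynomial in
    [h] is determined by its constant term and its derivative, and at [h = 0]
    both bracketings are the wedge product; comparing coefficients by induction
    yields [triple_assoc].

    Supercommutativity.  The same recursion reduces it to the wedge product: on
    a form of degree [p + 1] the contractions in the first and the last slot
    differ by [(-1)^p], and the three signs produced by one step, including the
    one from [w^(ij) = - w^(ji)], combine to the required one.

    Everything is then transported from constant forms to polynomials in [h] by
    bilinearity over [k[h]].  As the product reduces to the wedge product at
    [h = 0], the classical limit is the exterior algebra, the isomorphism from
    the quotient by the multiples of [h] being the constant term. *)

Set Implicit Arguments.
Unset Strict Implicit.
Unset Printing Implicit Defensive.

Import GRing.Theory.
Local Open Scope ring_scope.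

(** * Contractions and the grading involution *)

Section Contractions.
Variables (k : fieldType) (V : vectType k).
Implicit Types (x y z : extalg V) (u v : V) (s t : seq V) (p q : nat).

Lemma ext_swap x s u v t : x (s ++ u :: v :: t) = - x (s ++ v :: u :: t).
Proof.
have xx r a r' : x (r ++ a :: a :: r') = 0.
  by rewrite ext_alt // cat_uniq /= inE eqxx /= !andbF.
have xD r a b r' : x (r ++ (a + b) :: r') = x (r ++ a :: r') + x (r ++ b :: r').
  by rewrite -[a in LHS]scale1r ext_lin mul1r.
apply/eqP; rewrite -addr_eq0 -[X in _ == X](xx s (u + v) t) xD.
by rewrite -!(cat_rcons _ s) !xD !cat_rcons !xx add0r addr0.
Qed.

(** Moving [v] past the entries of [t] is [size t] adjacent transpositions. *)
Lemma ext_rot x s v t : x (s ++ rcons t v) = (-1) ^+ size t * x (s ++ v :: t).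
Proof.
elim: t s => [|u t IHt] s; first by rewrite mul1r.
by rewrite /= -cat_rcons IHt cat_rcons ext_swap exprS mulN1r mulrN mulNr.
Qed.

Lemma gradeinv_subproof x : (fun s => (-1) ^+ size s * x s) \in @altform k V.
Proof.
case/altformP: (valP x) => mx ax; apply/altformP; split.
  exact: multilinear_sg.
by move=> s us; rewrite ax ?mulr0.
Qed.

Definition gradeinv x : extalg V := ExtAlg (gradeinv_subproof x).

Lemma gradeinvK : involutive gradeinv.
Proof. by move=> x; apply: extP => s /=; rewrite mulrA -expr2 sqrr_sign mul1r. Qed.

Lemma gradeinvM x y : gradeinv (x * y) = gradeinv x * gradeinv y.
Proof. by apply: extP => s; apply: sg_wedge. Qed.

Lemma gradeinv_is_linear : linear gradeinv.
Proof. by move=> a x y; apply: extP => s /=; rewrite mulrDr mulrCA. Qed.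

HB.instance Definition _ :=
  GRing.isLinear.Build k (extalg V) (extalg V) _ gradeinv gradeinv_is_linear.

Lemma lcontr_is_linear v : linear (lcontr v : extalg V -> extalg V).
Proof. by move=> a x y; apply: extP. Qed.

HB.instance Definition _ v :=
  GRing.isLinear.Build k (extalg V) (extalg V) _ (lcontr v) (lcontr_is_linear v).

(** This reduces every statement on contraction in the last slot to one on the
    first slot. *)
Lemma rcontrE x v : rcontr x v = gradeinv (lcontr v x).
Proof. by apply: extP => s; apply: (ext_rot x [::]). Qed.

Lemma lcontr_gradeinv x v : lcontr v (gradeinv x) = - gradeinv (lcontr v x).
Proof. by apply: extP => s; apply: lcontr_sg. Qed.

Lemma rcontr_gradeinv x v : rcontr (gradeinv x) v = - gradeinv (rcontr x v).
Proof. by rewrite !rcontrE lcontr_gradeinv linearN. Qed.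

Lemma lcontr_anti x u v : lcontr u (lcontr v x) = - lcontr v (lcontr u x).
Proof. by apply: extP => s; apply: (ext_swap x [::]). Qed.

Lemma rcontr_lcontr x u v : rcontr (lcontr u x) v = lcontr u (rcontr x v).
Proof. by apply: extP. Qed.

Lemma rcontrZD v a x y : rcontr (a *: x + y) v = a *: rcontr x v + rcontr y v.
Proof. by apply: extP. Qed.

(** Contraction in the first slot is an odd derivation acting from the left; in
    [rcontrM] the one in the last slot acts from the right. *)
Lemma lcontrM v x y : lcontr v (x * y) = lcontr v x * y + gradeinv x * lcontr v y.
Proof. by apply: extP => s; apply: wedge_fun_cons. Qed.

Lemma rcontrM v x y : rcontr (x * y) v = rcontr x v * gradeinv y + x * rcontr y v.
Proof.
by rewrite !rcontrE lcontrM raddfD /= !gradeinvM gradeinvK.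
Qed.

Lemma degree_gradeinv p x : of_degree p x -> gradeinv x = (-1) ^+ p *: x.
Proof.
move=> dx; apply: extP => s; rewrite extZE /=.
by case: (eqVneq (x s) 0) => [->|/dx->] //; rewrite !mulr0.
Qed.

Lemma degree_lcontr p x v : of_degree p.+1 x -> of_degree p (lcontr v x).
Proof. by move=> dx s /dx[]. Qed.

Lemma degree0_lcontr x v : of_degree 0 x -> lcontr v x = 0.
Proof. by move=> dx; apply: extP => s; apply/eqP/negP => /negP/dx. Qed.

(** Induction on the number of arguments: contracting both sides by the first
    one lowers the degree of one factor. *)
Lemma wedgeC p q x y : of_degree p x -> of_degree q y ->
  x * y = (-1) ^+ (p * q) *: (y * x).
Proof.
move=> + + ; move=> dx dy; apply: extP => s.
elim: s p q x y dx dy => [|v s IHs] p q x y dx dy.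
  rewrite extZE [(x * y) _]wedge_fun_nil [(y * x) _]wedge_fun_nil.
  have [x0|/dx/= <-] := eqVneq (x [::]) 0; first by rewrite x0 mul0r !mulr0.
  by rewrite mul0n mul1r mulrC.
have cE z : z (v :: s) = lcontr v z s by [].
rewrite extZE !cE !lcontrM !extDE.
rewrite (degree_gradeinv dx) (degree_gradeinv dy) -!scalerAl !extZE.
(* For [p = 0] the degree cannot drop, but then the contraction vanishes and
   the sign is irrelevant. *)
have -> : (lcontr v x * y) s
    = (-1) ^+ (p * q) * ((-1) ^+ q * (y * lcontr v x) s).
  case: p dx => [|p] dx.
    by rewrite degree0_lcontr // mul0r mulr0 !mulr0.
  rewrite (IHs _ _ _ _ (degree_lcontr dx) dy) extZE.
  by rewrite mulSn exprD mulrACA -expr2 sqrr_sign mul1r.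
have -> : (x * lcontr v y) s
    = (-1) ^+ (p * q) * ((-1) ^+ p * (lcontr v y * x) s).
  case: q dy => [|q] dy.
    by rewrite degree0_lcontr // mul0r mulr0 !mulr0.
  rewrite (IHs _ _ _ _ dx (degree_lcontr dy)) extZE.
  by rewrite mulnS exprD mulrACA -expr2 sqrr_sign mul1r.
rewrite mulrDr [RHS]addrC; congr (_ + _).
by rewrite mulrCA [(-1) ^+ p * (_ * _)]mulrA -expr2 sqrr_sign mul1r.
Qed.

Lemma lcontr1 v : lcontr v 1 = 0 :> extalg V.
Proof. by apply: extP. Qed.

Lemma rcontr1 v : rcontr 1 v = 0 :> extalg V.
Proof. by rewrite rcontrE lcontr1 linear0. Qed.

End Contractions.

(** * The coefficients of the product of two constant forms *)

Lemma sum_tuple_cons (A : nmodType) (T : finType) n (F : n.+1.-tuple T -> A) :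
  \sum_(t : n.+1.-tuple T) F t = \sum_(i : T) \sum_(t : n.-tuple T) F [tuple of i :: t].
Proof.
rewrite pair_big /= (reindex (fun p : T * n.-tuple T => [tuple of p.1 :: p.2])) //.
exists (fun t => (thead t, [tuple of behead t])) => [[i t] _|t _] /=.
  by congr (_, _); apply: val_inj.
by rewrite -tuple_eta.
Qed.

Lemma sum_tuple0 (A : nmodType) (T : finType) (F : 0.-tuple T -> A) :
  \sum_(t : 0.-tuple T) F t = F [tuple].
Proof. by rewrite (big_pred1 [tuple]) // => t; rewrite (tuple0 t) [RHS]eqxx. Qed.

(** The Leibniz rule for the derivative of a two-variable power series along the
    diagonal, in terms of coefficients: [fl] and [fr] are its two partial
    derivatives. *)
Lemma convolution_leibniz (R : nzRingType) (A : lmodType R)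
    (f fl fr : nat -> nat -> A) n :
  (forall a b, a.+1%:R *: f a.+1 b = fl a b) ->
  (forall a b, b.+1%:R *: f a b.+1 = fr a b) ->
  n.+1%:R *: \sum_(a < n.+2) f a (n.+1 - a)%N
    = \sum_(a < n.+1) (fl a (n - a)%N + fr a (n - a)%N).
Proof.
move=> fE frE.
transitivity (\sum_(a < n.+2) a%:R *: f a (n.+1 - a)%N
            + \sum_(a < n.+2) (n.+1 - a)%:R *: f a (n.+1 - a)%N).
  rewrite -big_split scaler_sumr; apply: eq_bigr => a _ /=.
  by rewrite -scalerDl -natrD subnKC // -ltnS.
rewrite [X in X + _]big_ord_recl scale0r add0r.
rewrite [X in _ + X]big_ord_recr /= subnn scale0r addr0 -big_split.
apply: eq_bigr => -[a /= an] _; rewrite fE subSS.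
by rewrite -frE subSn.
Qed.

Section QuantumCoefficients.
Variables (k : fieldType) (V : vectType k).
Variables (w : extalg (dualv V)) (e : (\dim {: V}).-tuple V).
Implicit Types (x y z : extalg V) (u v : V) (n p q : nat).

(** Contraction of a bilinear operation with the bivector [w], the first
    arguments being contracted in the last slot. *)
Definition pairing (F : extalg V -> extalg V -> extalg V) x y : extalg V :=
  \sum_i \sum_j wcoef w e i j *: F (rcontr x (tnth e i)) (lcontr (tnth e j) y).

Fixpoint iter_pairing n : extalg V -> extalg V -> extalg V :=
  if n is n'.+1 then pairing (iter_pairing n') else *%R.

Local Notation P := iter_pairing.
Local Notation c := (qwedge_coef w e).

Lemma iter_pairingS n x y : P n.+1 x y =
  \sum_i \sum_j
    wcoef w e i j *: P n (rcontr x (tnth e i)) (lcontr (tnth e j) y).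
Proof. by []. Qed.

(** Splitting off the first index of both tuples turns the multiple sum into an
    iteration. *)
Lemma qwedge_coefE n x y : c n x y = (n`!%:R)^-1 *: P n x y.
Proof.
congr (_ *: _); elim: n x y => [|n IHn] x y.
  by rewrite !sum_tuple0 big_ord0 scale1r.
rewrite iter_pairingS sum_tuple_cons; apply: eq_bigr => i _ /=.
under eq_bigr do rewrite sum_tuple_cons.
rewrite exchange_big; apply: eq_bigr => j _ /=.
rewrite -IHn scaler_sumr; apply: eq_bigr => I _.
rewrite scaler_sumr; apply: eq_bigr => J _.
rewrite big_ord_recl !tnth0 scalerA; congr (_ * _ *: _).
by apply: eq_bigr => m _; rewrite !tnthS.
Qed.

Lemma iter_pairing_linl n y : linear ((P n)^~ y).
Proof.
elim: n y => [|n IHn] y a x x'; first by rewrite /= mulrDl scalerAl.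
rewrite !iter_pairingS scaler_sumr -big_split; apply: eq_bigr => i _ /=.
rewrite scaler_sumr -big_split; apply: eq_bigr => j _ /=.
by rewrite rcontrZD [P n _ _]IHn scalerDr !scalerA mulrC.
Qed.

Lemma iter_pairing0l n y : P n 0 y = 0.
Proof.
rewrite -[0 in LHS](addrN 0) -[- 0]scaleN1r addrC.
by rewrite [LHS]iter_pairing_linl scaleN1r addNr.
Qed.

Lemma iter_pairingZl n a x y : P n (a *: x) y = a *: P n x y.
Proof. by rewrite -[a *: x]addr0 [LHS]iter_pairing_linl iter_pairing0l addr0. Qed.

Lemma iter_pairing_linr n x : linear (P n x).
Proof.
elim: n x => [|n IHn] x a y y'; first by rewrite /= mulrDr scalerAr.
rewrite !iter_pairingS scaler_sumr -big_split; apply: eq_bigr => i _ /=.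
rewrite scaler_sumr -big_split; apply: eq_bigr => j _ /=.
by rewrite linearD linearZ [P n _ _]IHn scalerDr !scalerA mulrC.
Qed.

HB.instance Definition _ n x :=
  GRing.isLinear.Build k (extalg V) (extalg V) _ (P n x) (iter_pairing_linr n x).

Lemma iter_pairingZr n a x y : P n x (a *: y) = a *: P n x y.
Proof. exact: linearZ. Qed.

Lemma qwedge_coef_linl n y : linear ((c n)^~ y).
Proof.
move=> a x x'; rewrite !qwedge_coefE [P n _ _]iter_pairing_linl.
by rewrite scalerDr !scalerA mulrC.
Qed.

Lemma qwedge_coef_linr n x : linear (c n x).
Proof.
move=> a y y'; rewrite !qwedge_coefE [P n _ _]iter_pairing_linr.
by rewrite scalerDr !scalerA mulrC.
Qed.

(** The order of the arguments lets linearity in the left factor be declared. *)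
Definition rev_qwedge_coef n y x := c n x y.

HB.instance Definition _ n x :=
  GRing.isLinear.Build k (extalg V) (extalg V) _ (c n x) (qwedge_coef_linr n x).
HB.instance Definition _ n y :=
  GRing.isLinear.Build k (extalg V) (extalg V) _ (rev_qwedge_coef n y)
    (qwedge_coef_linl n y).

Lemma qwedge_coefDl n x x' y : c n (x + x') y = c n x y + c n x' y.
Proof. exact: (linearD (rev_qwedge_coef n y)). Qed.

Lemma qwedge_coefZl n a x y : c n (a *: x) y = a *: c n x y.
Proof. exact: (linearZ_LR (rev_qwedge_coef n y)). Qed.

Lemma qwedge_coef0l n y : c n 0 y = 0.
Proof. exact: (linear0 (rev_qwedge_coef n y)). Qed.

Lemma qwedge_coefDr n x y y' : c n x (y + y') = c n x y + c n x y'.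
Proof. exact: linearD. Qed.

Lemma qwedge_coefZr n a x y : c n x (a *: y) = a *: c n x y.
Proof. exact: linearZ. Qed.

Lemma qwedge_coef0r n x : c n x 0 = 0.
Proof. exact: linear0. Qed.

Lemma rcontrN x v : rcontr (- x) v = - rcontr x v.
Proof. by apply: extP. Qed.

Lemma iter_pairingNN n x y : P n (- x) (- y) = P n x y.
Proof.
elim: n x y => [|n IHn] x y; first exact: mulrNN.
rewrite !iter_pairingS; do 2 (apply: eq_bigr => ? _).
by rewrite rcontrN raddfN IHn.
Qed.

Lemma iter_pairingNl n x y : P n (- x) y = P n x (- y).
Proof. by rewrite -iter_pairingNN opprK. Qed.

(** One step of the iteration contributes a sign on each side: [lcontr v] passes
    [lcontr e_j] on the second factor, while [gradeinv] passes [rcontr e_i] on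
    the first one.  They cancel. *)
Lemma lcontr_iter_pairing n v x y : lcontr v (P n x y) =
  P n (lcontr v x) y + P n (gradeinv x) (lcontr v y).
Proof.
elim: n x y => [|n IHn] x y; first exact: lcontrM.
rewrite !iter_pairingS linear_sum -big_split; apply: eq_bigr => i _ /=.
rewrite linear_sum -big_split; apply: eq_bigr => j _ /=.
rewrite linearZ /= IHn -scalerDr rcontr_gradeinv rcontr_lcontr.
by rewrite [lcontr v (lcontr _ y)]lcontr_anti iter_pairingNl.
Qed.

Lemma gradeinv_iter_pairing n x y :
  gradeinv (P n x y) = P n (gradeinv x) (gradeinv y).
Proof.
elim: n x y => [|n IHn] x y; first exact: gradeinvM.
rewrite !iter_pairingS linear_sum; apply: eq_bigr => i _ /=.
rewrite linear_sum; apply: eq_bigr => j _ /=.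
by rewrite linearZ /= IHn rcontr_gradeinv lcontr_gradeinv iter_pairingNN.
Qed.

Lemma rcontr_iter_pairing n v x y : rcontr (P n x y) v =
  P n (rcontr x v) (gradeinv y) + P n x (rcontr y v).
Proof.
by rewrite !rcontrE lcontr_iter_pairing linearD /= !gradeinv_iter_pairing gradeinvK.
Qed.

Lemma lcontr_qwedge_coef n v x y : lcontr v (c n x y) =
  c n (lcontr v x) y + c n (gradeinv x) (lcontr v y).
Proof. by rewrite !qwedge_coefE linearZ /= lcontr_iter_pairing scalerDr. Qed.

Lemma rcontr_qwedge_coef n v x y : rcontr (c n x y) v =
  c n (rcontr x v) (gradeinv y) + c n x (rcontr y v).
Proof.
by rewrite !qwedge_coefE rcontrE linearZ linearZ /= -rcontrE
  rcontr_iter_pairing scalerDr.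
Qed.

Lemma qwedge_coef0 x y : c 0 x y = x * y.
Proof. by rewrite qwedge_coefE fact0 invr1 scale1r. Qed.

Lemma qwedge_coef1l n y : c n 1 y = if n is 0 then y else 0.
Proof.
case: n => [|n]; first by rewrite qwedge_coef0 mul1r.
rewrite qwedge_coefE iter_pairingS big1 ?scaler0 // => i _; apply: big1 => j _.
by rewrite rcontr1 iter_pairing0l scaler0.
Qed.

Lemma qwedge_coef1r n x : c n x 1 = if n is 0 then x else 0.
Proof.
case: n => [|n]; first by rewrite qwedge_coef0 mulr1.
rewrite qwedge_coefE iter_pairingS big1 ?scaler0 // => i _; apply: big1 => j _.
by rewrite lcontr1 (raddf0 (P n _)) scaler0.
Qed.

Hypothesis chark0 : [pchar k] =i pred0.

(** The differential equation of the product, coefficientwise. *)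
Lemma qwedge_coefS n x y : n.+1%:R *: c n.+1 x y = pairing (c n) x y.
Proof.
rewrite qwedge_coefE iter_pairingS scalerA factS natrM invfM mulrA.
have n0 : (n.+1%:R : k) != 0 by rewrite ((pcharf0P k).1 chark0).
rewrite mulfV // mul1r scaler_sumr; apply: eq_bigr => i _.
rewrite scaler_sumr; apply: eq_bigr => j _.
by rewrite qwedge_coefE !scalerA mulrC.
Qed.

Lemma degree_rcontr p x v : of_degree p.+1 x -> of_degree p (rcontr x v).
Proof. by move=> dx s /dx; rewrite size_rcons => -[]. Qed.

Lemma wcoef_anti i j : wcoef w e i j = - wcoef w e j i.
Proof. exact: (ext_swap w [::]). Qed.

(** Induction on [n].  Exchanging the factors after one pairing costs
    [(-1)^(p q)] for degrees [p + 1], [q + 1], exchanging first and last slots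
    costs [(-1)^(p + q)], and the antisymmetry of [w] costs [- 1]; the product
    is [(-1)^((p + 1)(q + 1))]. *)
Lemma qwedge_coefC n p q x y : of_degree p x -> of_degree q y ->
  c n x y = (-1) ^+ (p * q) *: c n y x.
Proof.
rewrite !qwedge_coefE scalerA mulrC -scalerA => dx dy; congr (_ *: _).
elim: n p q x y dx dy => [|n IHn] p q x y dx dy; first exact: wedgeC.
rewrite !iter_pairingS [in RHS]exchange_big scaler_sumr; apply: eq_bigr => i _ /=.
rewrite scaler_sumr; apply: eq_bigr => j _ /=.
case: p dx => [|p] dx.
  have l0 v : lcontr v x = 0 by apply: degree0_lcontr.
  by rewrite !rcontrE !l0 (raddf0 (@gradeinv k V)) iter_pairing0l
    (raddf0 (P n _)) !scaler0.
case: q dy => [|q] dy.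
  have l0 v : lcontr v y = 0 by apply: degree0_lcontr.
  by rewrite !rcontrE !l0 (raddf0 (@gradeinv k V)) iter_pairing0l
    (raddf0 (P n _)) !scaler0.
rewrite (IHn p q) //; [|exact: degree_rcontr|exact: degree_lcontr].
rewrite !rcontrE (degree_gradeinv (degree_lcontr dx)).
rewrite (degree_gradeinv (degree_lcontr dy)) iter_pairingZr iter_pairingZl !scalerA.
congr (_ *: _); rewrite [wcoef w e i j]wcoef_anti mulSn mulnS !exprD.
rewrite exprS mulN1r !mulNr.
congr (- _); rewrite [RHS]mulrC -!mulrA [RHS]mulrA -expr2 sqrr_sign mul1r.
by rewrite mulrC [X in X * _]mulrC -mulrA.
Qed.

(** * Associativity *)

(** Coefficients of [h^n] in the two bracketings of a triple product. *)
Definition left_triple n x y z : extalg V :=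
  \sum_(a < n.+1) c (n - a) (c a x y) z.
Definition right_triple n x y z : extalg V :=
  \sum_(a < n.+1) c (n - a) x (c a y z).

(** The sum of the pairings of two out of three factors.  In the pairing of the
    outer two the contractions pass the middle factor, whence the grading
    involution. *)
Definition triple_pairing (F : extalg V -> extalg V -> extalg V -> extalg V) x y z :=
  \sum_i \sum_j wcoef w e i j *:
    (F (rcontr x (tnth e i)) (lcontr (tnth e j) y) z
     + F (rcontr x (tnth e i)) (gradeinv y) (lcontr (tnth e j) z)
     + F x (rcontr y (tnth e i)) (lcontr (tnth e j) z)).

Lemma qwedge_coef_pairingl n F x y z : c n (pairing F x y) z =
  \sum_i \sum_j
    wcoef w e i j *: c n (F (rcontr x (tnth e i)) (lcontr (tnth e j) y)) z.
Proof.
rewrite -[LHS]/(rev_qwedge_coef n z _) linear_sum.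
apply: eq_bigr => i _; rewrite linear_sum.
by apply: eq_bigr => j _; rewrite linearZ.
Qed.

Lemma qwedge_coef_pairingr n F x y z : c n x (pairing F y z) =
  \sum_i \sum_j
    wcoef w e i j *: c n x (F (rcontr y (tnth e i)) (lcontr (tnth e j) z)).
Proof.
rewrite linear_sum; apply: eq_bigr => i _; rewrite linear_sum.
by apply: eq_bigr => j _; rewrite linearZ.
Qed.

(** The derivation rule for [rcontr] distributes the outer pairing of the
    left bracketing over [x] and [y]. *)
Lemma left_tripleS n x y z :
  n.+1%:R *: left_triple n.+1 x y z = triple_pairing (left_triple n) x y z.
Proof.
rewrite (@convolution_leibniz _ _ (fun a b => c b (c a x y) z)
  (fun a b => c b (pairing (c a) x y) z)
  (fun a b => pairing (c b) (c a x y) z)); first last.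
- by move=> a b; rewrite qwedge_coefS.
- by move=> a b; rewrite -qwedge_coefS qwedge_coefZl.
under eq_bigr do rewrite qwedge_coef_pairingl -big_split.
rewrite exchange_big; apply: eq_bigr => i _ /=.
under eq_bigr do rewrite -big_split.
rewrite exchange_big; apply: eq_bigr => j _ /=.
rewrite -!big_split scaler_sumr; apply: eq_bigr => a _ /=.
rewrite -scalerDr -addrA; congr (_ *: (_ + _)).
by rewrite rcontr_qwedge_coef qwedge_coefDl.
Qed.

(** The derivation rule for [lcontr] distributes the outer pairing of the
    right bracketing over [y] and [z]. *)
Lemma right_tripleS n x y z :
  n.+1%:R *: right_triple n.+1 x y z = triple_pairing (right_triple n) x y z.
Proof.
rewrite (@convolution_leibniz _ _ (fun a b => c b x (c a y z))
  (fun a b => c b x (pairing (c a) y z))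
  (fun a b => pairing (c b) x (c a y z))); first last.
- by move=> a b; rewrite qwedge_coefS.
- by move=> a b; rewrite -qwedge_coefS qwedge_coefZr.
under eq_bigr do rewrite qwedge_coef_pairingr -big_split.
rewrite exchange_big; apply: eq_bigr => i _ /=.
under eq_bigr do rewrite -big_split.
rewrite exchange_big; apply: eq_bigr => j _ /=.
rewrite -!big_split scaler_sumr; apply: eq_bigr => a _ /=.
rewrite -scalerDr addrC; congr (_ *: (_ + _)).
by rewrite lcontr_qwedge_coef qwedge_coefDr.
Qed.

(** Both sides satisfy the same first-order equation with the same initial
    value, the associative wedge product. *)
Lemma triple_assoc n x y z : left_triple n x y z = right_triple n x y z.
Proof.
elim: n x y z => [|n IHn] x y z.
  by rewrite /left_triple /right_triple !big_ord1 !qwedge_coef0 mulrA.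
have n0 : (n.+1%:R : k) != 0 by rewrite ((pcharf0P k).1 chark0).
apply: (scalerI n0); rewrite left_tripleS right_tripleS.
by do 2 (apply: eq_bigr => ? _); rewrite !IHn.
Qed.

End QuantumCoefficients.

(** * Polynomials in the formal parameter *)

Section PolyhCoefficients.
Variables (k : fieldType) (A : algType k).
Implicit Types (x y : polyh A) (n : nat).

(** Named so that coefficient extraction is additive for the structures of
    [polyh A] rather than those of [{poly A}]. *)
Definition hcoef n x : A := (x : {poly A})`_n.

Lemma hcoefP x y : (forall n, hcoef n x = hcoef n y) -> x = y.
Proof. by move=> xy; apply/polyP. Qed.

Lemma hcoef_is_zmod_morphism n : zmod_morphism (hcoef n).
Proof. by move=> x y; apply: coefB. Qed.

HB.instance Definition _ n :=
  GRing.isZmodMorphism.Build (polyh A) A (hcoef n) (hcoef_is_zmod_morphism n).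

Lemma hcoefXn m n x : hcoef n ('X^m *: x) = if (n < m)%N then 0 else hcoef (n - m) x.
Proof.
by rewrite /hcoef [_ *: _]/(map_poly _ _ * _) map_polyXn coefXnM.
Qed.

Lemma hcoefX n x : hcoef n ('X *: x) = if n is n'.+1 then hcoef n' x else 0.
Proof. by rewrite -['X]expr1 hcoefXn; case: n => // n; rewrite subSS subn0. Qed.

Lemma hcoefZ n (c : k) x : hcoef n (c%:P *: x) = c *: hcoef n x.
Proof.
rewrite /hcoef [_ *: _]/(map_poly _ _ * _) map_polyC /= coefCM.
by rewrite -scalerAl mul1r.
Qed.

Lemma hcoefC n (a : A) : hcoef n (a%:P : {poly A}) = if n is 0 then a else 0.
Proof. by rewrite /hcoef coefC; case: n. Qed.

(** [polyh A] is generated over [k[h]] by the constants, so statements that are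
    additive and compatible with [h] need only be checked on constants. *)
Lemma polyh_ind (K : polyh A -> Prop) :
  (forall a : A, K (a%:P : {poly A})) -> (forall x, K x -> K ('X *: x)) ->
  (forall x y, K x -> K y -> K (x + y)) -> forall x, K x.
Proof.
move=> KC KX KD; apply: (@poly_ind A K) => [|x a Kx]; first exact: (KC 0).
have -> : x * 'X = 'X *: (x : polyh A).
  by apply: hcoefP => n; rewrite hcoefX /hcoef coefMX; case: n.
exact: KD (KX _ Kx) (KC a).
Qed.

Lemma polyh_scaler (f : polyh A -> polyh A) :
    {morph f : x y / x + y} -> (forall x, f ('X *: x) = 'X *: f x) ->
    (forall (c : k) x, f (c%:P *: x) = c%:P *: f x) ->
  forall (c : {poly k}) x, f (c *: x) = c *: f x.
Proof.
move=> fD fX fC; elim/poly_ind => [|c a IHc] x.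
  by have := fC 0 x; rewrite polyC0 !scale0r.
by rewrite !scalerDl fD fC -!scalerA IHc fX.
Qed.

End PolyhCoefficients.

Lemma sum_ord_support (A : nmodType) (F : nat -> A) m n :
  (forall a, (minn m n <= a)%N -> F a = 0) -> \sum_(a < m) F a = \sum_(a < n) F a.
Proof.
wlog mn : m n / (m <= n)%N => [IH F0|].
  by case: (leqP m n) => [|/ltnW] le; [|symmetry]; apply: IH => // a; rewrite minnC;
   apply: F0.
rewrite (minn_idPl mn) => F0; rewrite (big_ord_widen n F mn) big_mkcond.
by apply: eq_bigr => a _; case: ltnP => // /F0.
Qed.

Section QuantumProduct.
Variables (k : fieldType) (V : vectType k).
Variables (w : extalg (dualv V)) (e : (\dim {: V}).-tuple V).
Local Notation A := (extalg V).
Local Notation c := (qwedge_coef w e).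
Local Notation "x ∧ y" := (qwedge w e x y) (at level 40).
Implicit Types (x y z : polyh A) (n p q : nat).

Lemma hcoef_qwedge_ext n (a b : A) : hcoef n (qwedge_ext w e a b) = c n a b.
Proof.
rewrite /hcoef coef_poly ltnS; case: leqP => // dn.
by rewrite qwedge_coef_gt_dim.
Qed.

(** The bounds are free because all other terms vanish; independence of the
    sizes of [x] and [y] is what makes bilinearity visible. *)
Lemma hcoef_qwedge m1 m2 n x y : (n < m1)%N -> (n < m2)%N ->
  hcoef n (x ∧ y) = \sum_(a < m1) \sum_(b < m2)
    if (a + b <= n)%N then c (n - (a + b)) (hcoef a x) (hcoef b y) else 0.
Proof.
move=> nm1 nm2; rewrite /qwedge raddf_sum /=.
have E a : hcoef n (\sum_(b < size (y : {poly A})) 'X^(a + b) *: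
    qwedge_ext w e (x : {poly A})`_a (y : {poly A})`_b) = \sum_(b < m2)
    if (a + b <= n)%N then c (n - (a + b)) (hcoef a x) (hcoef b y) else 0.
  transitivity (\sum_(b < m2) hcoef n ('X^(a + b) *:
    qwedge_ext w e (hcoef a x) (hcoef b y))); last first.
    by apply: eq_bigr => b _; rewrite hcoefXn hcoef_qwedge_ext ltnNge if_neg.
  rewrite raddf_sum /=.
  apply: (sum_ord_support (F := fun b => hcoef n ('X^(a + b) *:
    qwedge_ext w e (hcoef a x) (hcoef b y)))) => b.
  rewrite hcoefXn geq_min ltnNge; case: (leqP (a + b) n) => /= ab; last by [].
  case/orP => [sb|mb].
    by rewrite hcoef_qwedge_ext [hcoef b y]nth_default // qwedge_coef0r.
  by have := leq_trans nm2 mb; rewrite ltnNge (leq_trans (leq_addl a b) ab).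
under eq_bigr do rewrite E.
apply: (sum_ord_support (F := fun a => \sum_(b < m2)
    if (a + b <= n)%N then c (n - (a + b)) (hcoef a x) (hcoef b y) else 0)) => a.
rewrite geq_min => /orP[sa|ma]; apply: big1 => b _; case: leqP => // ab.
  by rewrite [hcoef a x]nth_default // qwedge_coef0l.
by have := leq_trans nm1 ma; rewrite ltnNge (leq_trans (leq_addr b a) ab).
Qed.

Lemma qwedgeDl x x' y : (x + x') ∧ y = x ∧ y + x' ∧ y.
Proof.
apply: hcoefP => n; rewrite raddfD /= !(@hcoef_qwedge n.+1 n.+1) //.
rewrite -big_split; apply: eq_bigr => a _ /=.
rewrite -big_split; apply: eq_bigr => b _ /=.
by case: leqP => _; rewrite ?addr0 // raddfD qwedge_coefDl.
Qed.

Lemma qwedgeDr x y y' : x ∧ (y + y') = x ∧ y + x ∧ y'.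
Proof.
apply: hcoefP => n; rewrite raddfD /= !(@hcoef_qwedge n.+1 n.+1) //.
rewrite -big_split; apply: eq_bigr => a _ /=.
rewrite -big_split; apply: eq_bigr => b _ /=.
by case: leqP => _; rewrite ?addr0 // raddfD qwedge_coefDr.
Qed.

Lemma qwedgeXl x y : ('X *: x) ∧ y = 'X *: (x ∧ y).
Proof.
apply: hcoefP => -[|n]; rewrite hcoefX /=.
  by rewrite (@hcoef_qwedge 1 1) // !big_ord1 hcoefX qwedge_coef0l.
rewrite (@hcoef_qwedge n.+2 n.+2) // (@hcoef_qwedge n.+1 n.+2) //.
rewrite big_ord_recl /= big1 ?add0r => [|b _].
  apply: eq_bigr => a _; apply: eq_bigr => b _ /=.
  by rewrite hcoefX /bump /= add1n addSn ltnS subSS.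
by rewrite hcoefX qwedge_coef0l if_same.
Qed.

Lemma qwedgeXr x y : x ∧ ('X *: y) = 'X *: (x ∧ y).
Proof.
apply: hcoefP => -[|n]; rewrite hcoefX /=.
  by rewrite (@hcoef_qwedge 1 1) // !big_ord1 hcoefX qwedge_coef0r.
rewrite (@hcoef_qwedge n.+2 n.+2) // (@hcoef_qwedge n.+2 n.+1) //.
apply: eq_bigr => a _; rewrite big_ord_recl /= hcoefX qwedge_coef0r if_same add0r.
apply: eq_bigr => b _ /=.
by rewrite hcoefX /bump /= add1n addnS ltnS subSS.
Qed.

Lemma qwedgeZl (f : {poly k}) x y : (f *: x) ∧ y = f *: (x ∧ y).
Proof.
apply: (polyh_scaler (f := fun x => x ∧ y)) => [x1 x2|x1|s x1].
- exact: qwedgeDl.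
- exact: qwedgeXl.
apply: hcoefP => n; rewrite hcoefZ !(@hcoef_qwedge n.+1 n.+1) // scaler_sumr.
apply: eq_bigr => a _; rewrite scaler_sumr; apply: eq_bigr => b _ /=.
by rewrite hcoefZ qwedge_coefZl; case: leqP => // _; rewrite scaler0.
Qed.

Lemma qwedgeZr (f : {poly k}) x y : x ∧ (f *: y) = f *: (x ∧ y).
Proof.
apply: (polyh_scaler (f := fun y => x ∧ y)) => [y1 y2|y1|s y1].
- exact: qwedgeDr.
- exact: qwedgeXr.
apply: hcoefP => n; rewrite hcoefZ !(@hcoef_qwedge n.+1 n.+1) // scaler_sumr.
apply: eq_bigr => a _; rewrite scaler_sumr; apply: eq_bigr => b _ /=.
by rewrite hcoefZ qwedge_coefZr; case: leqP => // _; rewrite scaler0.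
Qed.

Lemma hcoef_qwedgeC n x (b : A) :
  hcoef n (x ∧ (b%:P : {poly A})) = \sum_(i < n.+1) c (n - i) (hcoef i x) b.
Proof.
rewrite (@hcoef_qwedge n.+1 n.+1) //; apply: eq_bigr => i _.
rewrite big_ord_recl big1 ?addr0 /= => [|j _].
  by rewrite addn0 -ltnS ltn_ord hcoefC.
by rewrite hcoefC qwedge_coef0r if_same.
Qed.

Lemma hcoef_Cqwedge n (a : A) y :
  hcoef n ((a%:P : {poly A}) ∧ y) = \sum_(j < n.+1) c (n - j) a (hcoef j y).
Proof.
rewrite (@hcoef_qwedge n.+1 n.+1) // big_ord_recl [X in _ + X]big1 ?addr0 /= => [|i _].
  by apply: eq_bigr => j _; rewrite add0n -ltnS ltn_ord hcoefC.
by apply: big1 => j _; rewrite hcoefC qwedge_coef0l if_same.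
Qed.

Lemma hcoef_CqwedgeC n (a b : A) :
  hcoef n ((a%:P : {poly A}) ∧ (b%:P : {poly A})) = c n a b.
Proof.
rewrite hcoef_Cqwedge big_ord_recl big1 ?addr0 /= ?subn0 ?hcoefC // => i _.
by rewrite hcoefC qwedge_coef0r.
Qed.

Lemma hcoef0_qwedge x y : hcoef 0 (x ∧ y) = hcoef 0 x * hcoef 0 y.
Proof. by rewrite (@hcoef_qwedge 1 1) // !big_ord1 /= qwedge_coef0. Qed.

Hypothesis chark0 : [pchar k] =i pred0.

(** By trilinearity over [k[h]] it suffices to treat constants. *)
Lemma qwedgeA x y z : (x ∧ y) ∧ z = x ∧ (y ∧ z).
Proof.
elim/polyh_ind: x => [a|x IHx|x x' IHx IHx'].
- elim/polyh_ind: y => [b|y IHy|y y' IHy IHy'].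
  + elim/polyh_ind: z => [d|z IHz|z z' IHz IHz'].
    * apply: hcoefP => n; rewrite hcoef_qwedgeC hcoef_Cqwedge.
      under eq_bigr do rewrite hcoef_CqwedgeC.
      under [RHS]eq_bigr do rewrite hcoef_CqwedgeC.
      exact: triple_assoc.
    * by rewrite !qwedgeXr IHz.
    * by rewrite !qwedgeDr IHz IHz'.
  + by rewrite !(qwedgeXr, qwedgeXl) IHy.
  + by rewrite !(qwedgeDr, qwedgeDl) IHy IHy'.
- by rewrite !qwedgeXl IHx.
- by rewrite !qwedgeDl IHx IHx'.
Qed.

Lemma qwedge1l x : (1 : {poly A}) ∧ x = x.
Proof.
elim/polyh_ind: x => [a|x IHx|x y IHx IHy].
- apply: hcoefP => n; rewrite -polyC1 hcoef_CqwedgeC hcoefC.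
  by rewrite qwedge_coef1l.
- by rewrite qwedgeXr IHx.
- by rewrite qwedgeDr IHx IHy.
Qed.

Lemma qwedge1r x : x ∧ (1 : {poly A}) = x.
Proof.
elim/polyh_ind: x => [a|x IHx|x y IHx IHy].
- apply: hcoefP => n; rewrite -polyC1 hcoef_CqwedgeC hcoefC.
  by rewrite qwedge_coef1r.
- by rewrite qwedgeXl IHx.
- by rewrite qwedgeDl IHx IHy.
Qed.

(** As [h] has even degree, passing to coefficients does not change the parity. *)
Lemma homogeneous_hcoef p m x : homogeneous p x ->
  hcoef m x = 0 \/ exists2 q, p = (q + 2 * m)%N & of_degree q (hcoef m x).
Proof.
move=> hx; have [mp|pm] := leqP (2 * m) p.
  right; exists (p - 2 * m)%N; first by rewrite subnK.
  by move=> s /hx <-; rewrite addnK.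
left; apply: extP => s; apply/eqP/negP => /negP/hx sp.
by move: pm; rewrite -sp ltnNge leq_addl.
Qed.

Lemma qwedgeC p q x y : homogeneous p x -> homogeneous q y ->
  x ∧ y = (-1) ^+ (p * q) *: (y ∧ x).
Proof.
move=> hx hy; apply: hcoefP => n.
have -> : (-1) ^+ (p * q) = ((-1) ^+ (p * q))%:P :> {poly k}.
  by rewrite rmorphXn rmorphN1.
rewrite hcoefZ !(@hcoef_qwedge n.+1 n.+1) // [in RHS]exchange_big scaler_sumr.
apply: eq_bigr => a _; rewrite scaler_sumr; apply: eq_bigr => b _ /=.
rewrite [(b + a)%N]addnC; case: leqP => _; last by rewrite scaler0.
case: (homogeneous_hcoef a hx) => [->|[p' -> dx]].
  by rewrite qwedge_coef0l qwedge_coef0r scaler0.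
case: (homogeneous_hcoef b hy) => [->|[q' -> dy]].
  by rewrite qwedge_coef0l qwedge_coef0r scaler0.
rewrite (qwedge_coefC _ _ _ dx dy); congr (_ *: _).
by rewrite -[RHS]signr_odd oddM !mul2n !oddD !odd_double !addbF -oddM signr_odd.
Qed.

End QuantumProduct.

(** * The classical limit *)

Section ClassicalLimit.
Variables (k : fieldType) (A : algType k).
Local Notation Q := {ideal_quot @hmultiples k (polyh A)}.

Definition constant_term (q : Q) : A := hcoef 0 (repr q).

(** A polynomial is a multiple of [h] exactly when its constant term vanishes. *)
Lemma pi_eqP (x y : polyh A) : \pi_Q%qT x = \pi_Q%qT y <-> hcoef 0 x = hcoef 0 y.
Proof.
split=> [/eqP|xy]; last apply/eqP.
  rewrite -Quotient.idealrBE => /asboolP[z zE]; apply/eqP.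
  by rewrite -subr_eq0 -raddfB /= zE hcoefX.
rewrite -Quotient.idealrBE; apply/asboolP.
(* the quotient by [h]: all coefficients are shifted by one *)
exists (\poly_(i < size (x - y : {poly A})) (x - y : {poly A})`_i.+1 : {poly A}).
apply: hcoefP => -[|n]; rewrite hcoefX; first by rewrite raddfB /= xy subrr.
rewrite [RHS]coef_poly; case: ltnP => // sn.
by rewrite /hcoef nth_default // (leq_trans sn).
Qed.

Lemma constant_term_pi x : constant_term (\pi_Q%qT x) = hcoef 0 x.
Proof. by apply/pi_eqP; rewrite reprK. Qed.

Lemma constant_term_is_zmod_morphism : zmod_morphism constant_term.
Proof.
move=> q r; rewrite -[q]reprK -[r]reprK !piE !constant_term_pi.
exact: raddfB.
Qed.

HB.instance Definition _ :=
  GRing.isZmodMorphism.Build Q A constant_term constant_term_is_zmod_morphism.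

Lemma constant_term_bij : bijective constant_term.
Proof.
exists (fun a : A => \pi_Q%qT (a%:P : {poly A})) => [q|a].
  by rewrite -[RHS]reprK; apply/pi_eqP; rewrite hcoefC.
by rewrite constant_term_pi hcoefC.
Qed.

Lemma deformation_quantization_polyh (mul : polyh A -> polyh A -> polyh A) :
  is_kh_algebra mul (1 : {poly A}) ->
  (forall x y, hcoef 0 (mul x y) = hcoef 0 x * hcoef 0 y) ->
  @deformation_quantization k A (polyh A) mul (1 : {poly A}).
Proof.
move=> mulP mul0; split=> //; first by exists idfun; exists id.
exists constant_term; split=> [||x y|c x].
- exact: constant_term_bij.
- by apply: etrans (constant_term_pi _) _; have := hcoefC 0 (1 : A); rewrite polyC1.
- by apply: etrans (constant_term_pi _) _; rewrite mul0 -!constant_term_pi.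
- by apply: etrans (constant_term_pi _) _; rewrite hcoefZ -constant_term_pi.
Qed.

End ClassicalLimit.

Theorem theorem1p1 (k : fieldType) (chark0 : [pchar k] =i pred0)
    (V : vectType k) (w : extalg (dualv V)) (w_deg2 : of_degree 2 w)
    (e : (\dim {: V}).-tuple V) (e_basis : basis_of {: V} e) :
  [/\ forall (p q : nat) (x y : polyh (extalg V)),
        homogeneous p x -> homogeneous q y ->
        qwedge w e x y = (-1) ^+ (p * q) *: qwedge w e y x,
      forall x y z : polyh (extalg V),
        qwedge w e (qwedge w e x y) z = qwedge w e x (qwedge w e y z)
    & @deformation_quantization k (extalg V) (polyh (extalg V))
        (qwedge w e) (1 : {poly extalg V})].
Proof.
split; [exact: qwedgeC | exact: qwedgeA |].
apply: deformation_quantization_polyh; last exact: hcoef0_qwedge.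
split; first by move=> x y z; rewrite qwedgeA.
- exact: qwedge1l.
- exact: qwedge1r.
- exact: qwedgeDl.
- exact: qwedgeDr.
- exact: qwedgeZl.
- exact: qwedgeZr.
Qed.
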